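(* Let $p$ be a prime, $m$ a positive integer, $\xi_m(t)=\sum_{i=0}^{m-1}(-t)^i$, and let $X=\mathbb{Z}_p[t,t^{-1}]/(\xi_m(t))$, regarded as an Alexander quandle. Let $f:X\times X\to X$ be defined by $f(x_1,x_2)=(x_1-x_2)^{a_1}x_2^{a_2}$, where $a_i=p^{m_i}$ for $i=1,2$ and the $m_i$ are non-negative integers. Suppose that $\xi_m(t)$ divides $1-t^{a_1+a_2}$ in $\mathbb{Z}_p[t,t^{-1}]$. Then the quandle ($2$-)cocycle invariant $\Phi_f(T(2,m))$ of the torus knot $T(2,m)$ is given by the multiset $$\Phi_f(T(2,m))=\{\sqcup_{|X|}\,(t^2\xi_m'(t))^{a_2}s^{a_1+a_2}\ |\ s\in X\},$$ where $|X|$ is the number of elements of $X$ and $\xi_m'$ is the derivative of $\xi_m$ with respect to $t$. Moreover, with the same $X$ and $f$, the invariant $\Phi_f(T(2,-m))$ is the multiset consisting of the negatives of the elements of $\Phi_f(T(2,m))$.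
   Context: $\mathbb{Z}_p=\mathbb{Z}/p\mathbb{Z}$. A quandle is a set with a binary operation $*$ such that $a*a=a$; for all $a,b$ there is a unique $c$ with $a=c*b$; and $(a*b)*c=(a*c)*(b*c)$. Any $\mathbb{Z}[t,t^{-1}]$-module is a quandle (Alexander quandle) under $a*b=ta+(1-t)b$. A quandle $2$-cocycle with values in an abelian group $A$ is $\phi:X\times X\to A$ with $\phi(x,x)=0$ and $\phi(x,y)+\phi(x*y,z)=\phi(x,z)+\phi(x*z,y*z)$ for all $x,y,z\in X$. Here $A=X$ (additive group); under the hypotheses $f$ is a $2$-cocycle. For an integer $m>0$, $T(2,m)$ is the oriented knot or link that is the closure of the $2$-string braid with $m$ positive crossings (both strings oriented in parallel, downward); $T(2,-m)$ is the closure of the $2$-string braid with $m$ negative crossings. Colorings: for an oriented diagram $K$, each arc gets a normal such that (tangent, normal) is the positive orientation of the plane. A coloring by $X$ assigns an element of $X$ to each arc so that at every crossing with over-arc colored $y$, if $x$ is the color of the under-arc lying on the side from which the normal of the over-arc points (the source under-arc), then the other under-arc is colored $x*y$. The pair $(x_\tau,y_\tau)=(x,y)$ is the pair of source colors at the crossing $\tau$, and $\epsilon(\tau)=\pm1$ is the usual sign of the crossing. $\mathrm{Col}_X(K)$ is the set of colorings. The quandle cocycle invariant of a $2$-cocycle $\phi$ is the multiset $$\Phi_\phi(K)=\Big\{\sum_\tau\epsilon(\tau)\,\phi(x_\tau,y_\tau)\ \Big|\ \mathcal{C}\in\mathrm{Col}_X(K)\Big\}.$$ In a multiset, $\sqcup_k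 g$ denotes $k$ copies of $g$; so the displayed multiset contains, for each $s\in X$, $|X|$ copies of the indicated element. *)

(* Defs.v *)
From HB Require Import structures.
From mathcomp Require Import all_boot all_order all_algebra finmap multiset.
From mathcomp Require Import boolp.

Set Implicit Arguments.
Unset Strict Implicit.
Unset Printing Implicit Defensive.

Import GRing.Theory.
Local Open Scope ring_scope.

(* [laurent R] is R[t, t^-1], realised as the subring of the fraction field
   of R[t] made of the fractions q / t^n. *)
Definition laurent_pred (R : idomainType) : {pred {fraction {poly R}}} :=
  fun x => `[< exists (n : nat) (q : {poly R}),
                 x * (tofrac 'X) ^+ n = tofrac q >].

Fact laurent_subring_closed (R : idomainType) :
  subring_closed (@laurent_pred R).
Proof.
split.
- by apply/asboolP; exists 0%N, 1; rewrite mulr1 tofrac1.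
- move=> x y /asboolP[n [q hq]] /asboolP[k [r hr]]; apply/asboolP.
  exists (n + k)%N, (q * 'X^k - r * 'X^n).
  rewrite tofracB !tofracM !tofracXn -hq -hr exprD mulrBl.
  by rewrite mulrA [in X in _ - X]mulrCA [in X in _ - X]mulrC.
- move=> x y /asboolP[n [q hq]] /asboolP[k [r hr]]; apply/asboolP.
  by exists (n + k)%N, (q * r); rewrite tofracM -hq -hr exprD mulrACA.
Qed.

Record laurent (R : idomainType) := Laurent {
  laurent_val :> {fraction {poly R}};
  laurent_valP : laurent_val \in @laurent_pred R
}.

HB.instance Definition _ (R : idomainType) := [isSub for @laurent_val R].
HB.instance Definition _ (R : idomainType) := [Choice of laurent R by <:].
HB.instance Definition _ (R : idomainType) :=
  GRing.SubChoice_isSubComNzRing.Build _ _ (laurent R)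
    (@laurent_subring_closed R).

Fact poly_laurentP (R : idomainType) (q : {poly R}) :
  tofrac q \in @laurent_pred R.
Proof. by apply/asboolP; exists 0%N, q; rewrite mulr1. Qed.

Definition poly_laurent (R : idomainType) (q : {poly R}) : laurent R :=
  Laurent (poly_laurentP q).

Fact poly_laurent_zmod_morphism (R : idomainType) :
  zmod_morphism (@poly_laurent R).
Proof. by move=> x y; apply: val_inj; rewrite /= tofracB. Qed.
HB.instance Definition _ (R : idomainType) :=
  GRing.isZmodMorphism.Build {poly R} (laurent R) (@poly_laurent R)
    (@poly_laurent_zmod_morphism R).

Fact poly_laurent_monoid_morphism (R : idomainType) :
  monoid_morphism (@poly_laurent R).
Proof.
by split=> [|x y]; apply: val_inj; rewrite /= ?tofrac1 ?tofracM.
Qed.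
HB.instance Definition _ (R : idomainType) :=
  GRing.isMonoidMorphism.Build {poly R} (laurent R) (@poly_laurent R)
    (@poly_laurent_monoid_morphism R).

Fact laurent_tinvP (R : idomainType) :
  (tofrac ('X : {poly R}))^-1 \in @laurent_pred R.
Proof.
apply/asboolP; exists 1%N, 1; rewrite expr1 mulVf ?tofrac1 //.
by rewrite tofrac_eq0 polyX_eq0.
Qed.

Definition laurent_t (R : idomainType) : laurent R := poly_laurent 'X.
Definition laurent_tinv (R : idomainType) : laurent R :=
  Laurent (laurent_tinvP R).

Lemma laurent_tV (R : idomainType) : laurent_t R * laurent_tinv R = 1.
Proof. by apply: val_inj; rewrite /= divff // tofrac_eq0 polyX_eq0. Qed.

(* [{ideal_quot I}] requires I to be a proper ideal; here (a) may be the whole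
   ring (it is for xi_1 = 1), so the ring structure is put directly on the
   quotient abelian group. *)
Section PrincipalQuotient.
Variable (R : comNzRingType).

Definition divides (a x : R) : Prop := exists b, x = b * a.

Variable (a : R).

Definition principal : {pred R} := fun x => `[< divides a x >].

Fact principal_zmod_closed : zmod_closed principal.
Proof.
split=> [|x y /asboolP[b ->] /asboolP[c ->]]; apply/asboolP.
  by exists 0; rewrite mul0r.
by exists (b - c); rewrite mulrBl.
Qed.
HB.instance Definition _ :=
  GRing.isZmodClosed.Build R principal principal_zmod_closed.

Lemma principalM x y : y \in principal -> x * y \in principal.
Proof. by move=> /asboolP[b ->]; apply/asboolP; exists (x * b); rewrite mulrA. Qed.

Definition quot_principal : Type := Quotient.quot principal.
HB.instance Definition _ := GRing.Zmodule.on quot_principal.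

Definition quot_class (x : R) : quot_principal :=
  (\pi_(Quotient.quot principal) x)%qT.

Lemma quot_classP x y : quot_class x = quot_class y <-> divides a (x - y).
Proof.
split=> [/eqP|/asboolP dxy].
  by rewrite -(Quotient.idealrBE principal) => /asboolP.
by apply/eqP; rewrite -(Quotient.idealrBE principal).
Qed.

Definition quot_repr (x : quot_principal) : R :=
  repr (x : Quotient.quot principal).

Lemma quot_reprK : cancel quot_repr quot_class.
Proof. exact: reprK. Qed.

Definition quot_mul (x y : quot_principal) : quot_principal :=
  quot_class (quot_repr x * quot_repr y).

Lemma quot_class_mul x y :
  quot_mul (quot_class x) (quot_class y) = quot_class (x * y).
Proof.
apply/quot_classP; set x' := quot_repr _; set y' := quot_repr _.
have /quot_classP[b hb] : quot_class x' = quot_class x by rewrite quot_reprK.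
have /quot_classP[c hc] : quot_class y' = quot_class y by rewrite quot_reprK.
exists (b * y' + x * c).
by rewrite mulrDl mulrAC -hb -mulrA -hc mulrBl mulrBr addrA subrK.
Qed.

Fact quot_mulA : associative quot_mul.
Proof.
move=> x y z; rewrite -(quot_reprK x) -(quot_reprK y) -(quot_reprK z).
by rewrite !quot_class_mul mulrA.
Qed.
Fact quot_mulC : commutative quot_mul.
Proof. by move=> x y; rewrite /quot_mul mulrC. Qed.
Fact quot_mul1 : left_id (quot_class 1) quot_mul.
Proof.
by move=> x; rewrite -(quot_reprK x) quot_class_mul mul1r.
Qed.
Fact quot_class_zmod_morphism : zmod_morphism quot_class.
Proof. by move=> x y; rewrite /quot_class raddfB. Qed.
HB.instance Definition _ := GRing.isZmodMorphism.Build R quot_principal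
  quot_class quot_class_zmod_morphism.
Fact quot_mulDl : left_distributive quot_mul +%R.
Proof.
move=> x y z; rewrite -(quot_reprK x) -(quot_reprK y) -(quot_reprK z).
by rewrite -raddfD !quot_class_mul -raddfD mulrDl.
Qed.
HB.instance Definition _ := GRing.Zmodule_isComPzRing.Build quot_principal
  quot_mulA quot_mulC quot_mul1 quot_mulDl.

Fact quot_class_monoid_morphism : monoid_morphism quot_class.
Proof. by split=> // x y; rewrite -quot_class_mul. Qed.
HB.instance Definition _ := GRing.isMonoidMorphism.Build R quot_principal
  quot_class quot_class_monoid_morphism.

End PrincipalQuotient.

Record is_quandle (X : Type) (op : X -> X -> X) : Prop := IsQuandle {
  quandle_idem : forall a, op a a = a;
  quandle_div : forall a b, exists! c, a = op c b;
  quandle_distr : forall a b c, op (op a b) c = op (op a c) (op b c)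
}.

(* Only finite quandles are considered, so that colorings can be listed. *)
Record quandle := Quandle {
  quandle_sort :> finType;
  quandle_op : quandle_sort -> quandle_sort -> quandle_sort;
  quandleP : is_quandle quandle_op
}.

Record is_cocycle2 (X : quandle) (A : zmodType) (phi : X -> X -> A) : Prop :=
  IsCocycle2 {
    cocycle2_diag : forall x, phi x x = 0;
    cocycle2_eq : forall x y z,
      phi x y + phi (quandle_op x y) z =
      phi x z + phi (quandle_op x z) (quandle_op y z)
  }.

Record cocycle2 (X : quandle) (A : zmodType) := Cocycle2 {
  cocycle2_fun :> X -> X -> A;
  cocycle2P : is_cocycle2 cocycle2_fun
}.

(* A commutative ring with an invertible element t is a Z[t, t^-1]-module. *)
Section Alexander.
Variables (R : finComPzRingType) (t u : R).
Hypothesis tu : t * u = 1.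

Definition alexander_op (a b : R) : R := t * a + (1 - t) * b.

Fact alexander_quandleP : is_quandle alexander_op.
Proof.
split; rewrite /alexander_op.
- by move=> a; rewrite -mulrDl addrC subrK mul1r.
- move=> a b; exists (u * (a - (1 - t) * b)); split.
    by rewrite mulrA tu mul1r subrK.
  by move=> c ->; rewrite addrK mulrA [u * t]mulrC tu mul1r.
- move=> a b c.
  have e : t * ((1 - t) * c) + (1 - t) * ((1 - t) * c) = (1 - t) * c.
    by rewrite -mulrDl addrC subrK mul1r.
  by rewrite !mulrDr addrACA e [(1 - t) * (t * b)]mulrCA.
Qed.

Definition alexander : quandle := Quandle alexander_quandleP.
End Alexander.

(* The incidence data of an oriented diagram.  Edges are the oriented segments
   running from one crossing to the next (passing over or under); at each
   crossing, [over_in] and [over_out] are the two halves of the over-strand,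
   [under_in] and [under_out] those of the under-strand, in the direction of
   the orientation. *)
Record diagram := Diagram {
  edge : finType;
  crossing : finType;
  over_in : crossing -> edge;
  over_out : crossing -> edge;
  under_in : crossing -> edge;
  under_out : crossing -> edge;
  positive : crossing -> bool
}.

Section Diagram.
Variable D : diagram.

(* An arc runs from an undercrossing to the next one: it is a class of edges
   for the relation generated by continuing along an over-strand. *)
Definition over_step : rel (edge D) := fun e e' =>
  [exists tau : crossing D,
     ((e == over_in tau) && (e' == over_out tau)) ||
     ((e == over_out tau) && (e' == over_in tau))].

Definition edge_class (e : edge D) : {set edge D} :=
  [set e' | connect over_step e e'].

Definition arc : finType := {A : {set edge D} | A \in codom edge_class}.

Definition arc_of (e : edge D) : arc :=
  exist _ (edge_class e) (codom_f edge_class e).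

Definition over_arc (tau : crossing D) : arc := arc_of (over_in tau).

(* Normals point to the left of the oriented arcs, so the source under-arc
   lies on the right of the over-arc.  At a positive crossing the under-strand
   crosses the over-strand from right to left, at a negative one from left to
   right. *)
Definition source_arc (tau : crossing D) : arc :=
  arc_of (if positive tau then under_in tau else under_out tau).
Definition target_arc (tau : crossing D) : arc :=
  arc_of (if positive tau then under_out tau else under_in tau).

Variable X : quandle.

Definition is_coloring (C : {ffun arc -> X}) : bool :=
  [forall tau : crossing D,
     C (target_arc tau) == quandle_op (C (source_arc tau)) (C (over_arc tau))].

Definition colorings : {set {ffun arc -> X}} := [set C | is_coloring C].

Definition crossing_sign (tau : crossing D) : int :=
  if positive tau then 1 else -1.

Variables (A : zmodType) (phi : cocycle2 X A).

Definition coloring_weight (C : {ffun arc -> X}) : A :=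
  \sum_(tau : crossing D)
     phi (C (source_arc tau)) (C (over_arc tau)) *~ crossing_sign tau.

Definition cocycle_invariant : {mset A}%mset :=
  seq_mset [seq coloring_weight C | C <- enum colorings].

End Diagram.

(* The closure of the 2-string braid with |n| crossings of the sign of n
   (meaningful for n != 0).  The edges (k, false) and (k, true) are the left
   and right strings just above the k-th crossing, both oriented downward; the
   last crossing is followed by the 0-th one.  With this orientation the string
   going from top right to bottom left passes over at a positive crossing, and
   under at a negative one. *)
Definition torus_link2 (n : int) : diagram :=
  let pos := 0 < n in
  {| edge := ('I_`|n| * bool)%type;
     crossing := 'I_`|n|;
     over_in := fun k => (k, pos);
     over_out := fun k => (ordS k, ~~ pos);
     under_in := fun k => (k, ~~ pos);
     under_out := fun k => (ordS k, pos);
     positive := fun=> pos |}.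

Definition xi (p m : nat) : {poly 'F_p} := \sum_(i < m) (- 'X) ^+ i.

(* The condition 0 < m, without which the quotient is infinite, is part of the
   type so that finiteness can be inferred. *)
Definition Xring (p m : nat) (m_gt0 : (0 < m)%N) : Type :=
  quot_principal (poly_laurent (xi p m)).
HB.instance Definition _ p m m_gt0 := GRing.ComPzRing.on (@Xring p m m_gt0).

Section Xring.
Variables (p m : nat) (m_gt0 : (0 < m)%N).
Local Notation X := (Xring p m_gt0).

Definition Xclass : laurent 'F_p -> X :=
  @quot_class _ (poly_laurent (xi p m)).
HB.instance Definition _ := GRing.RMorphism.on Xclass.

Definition Xpoly (q : {poly 'F_p}) : X := Xclass (poly_laurent q).
HB.instance Definition _ := GRing.RMorphism.copy Xpoly (Xclass \o @poly_laurent _).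

Definition Xt : X := Xclass (laurent_t 'F_p).
Definition Xtinv : X := Xclass (laurent_tinv 'F_p).

Lemma Xt_V : Xt * Xtinv = 1.
Proof. by rewrite -rmorphM laurent_tV rmorph1. Qed.

Lemma Xpoly_xi : Xpoly (xi p m) = 0.
Proof.
by rewrite -(rmorph0 Xclass); apply/quot_classP; exists 1; rewrite subr0 mul1r.
Qed.

Lemma Xtinv_poly : exists r, Xtinv = Xpoly r.
Proof.
exists (\sum_(i < m.-1) (- 'X) ^+ i).
have /(congr1 ( *%R Xtinv)) := Xpoly_xi.
have -> : xi p m = 1 - 'X * \sum_(i < m.-1) (- 'X) ^+ i.
  rewrite /xi -[in LHS](prednK m_gt0) big_ord_recl expr0 mulr_sumr -sumrN.
  by congr (_ + _); apply: eq_bigr => i _; rewrite exprS mulNr.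
rewrite mulr0 rmorphB rmorph1 rmorphM mulrBr mulr1 mulrA [Xtinv * _]mulrC.
by rewrite Xt_V mul1r => /eqP; rewrite subr_eq0 => /eqP.
Qed.

Lemma size_xi : size (xi p m) = m.
Proof.
have szX i : size ((- 'X : {poly 'F_p}) ^+ i) = i.+1.
  by rewrite exprNn -signr_odd mulr_sign; case: ifP; rewrite ?size_polyN size_polyXn.
rewrite /xi -[in LHS](prednK m_gt0) -[in RHS](prednK m_gt0) big_ord_recr /=.
rewrite addrC size_polyDl szX // ltnS; apply: (leq_trans (size_sum _ _ _)).
by apply/bigmax_leqP => i _; rewrite szX.
Qed.

Lemma Xpoly_surj (x : X) : exists v : 'rV['F_p]_m, Xpoly (rVpoly v) = x.
Proof.
have [q <-] : exists q, Xpoly q = x.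
  rewrite -(quot_reprK x); set y := quot_repr x.
  have /asboolP[n [q hq]] := laurent_valP y; have [r hr] := Xtinv_poly.
  exists (q * r ^+ n).
  have -> : y = poly_laurent q * laurent_tinv 'F_p ^+ n.
    rewrite -[y]mulr1 -(expr1n _ n) -[in LHS]laurent_tV exprMn mulrA.
    congr (_ * _); apply: val_inj.
    by rewrite /laurent_t -rmorphXn /= tofracXn hq.
  by rewrite !rmorphM !rmorphXn /= -hr.
have sz : (size (q %% xi p m)%R <= m)%N.
  by rewrite ltnW // -[ltnRHS]size_xi ltn_modp -size_poly_eq0 size_xi -lt0n.
exists (poly_rV (q %% xi p m)); rewrite poly_rV_K //.
rewrite [in RHS](divp_eq q (xi p m)) rmorphD rmorphM [X in _ * X]Xpoly_xi.
by rewrite mulr0 add0r.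
Qed.

Fact Xcode_ex (x : X) : exists v : 'rV['F_p]_m, Xpoly (rVpoly v) == x.
Proof. by have [v <-] := Xpoly_surj x; exists v. Qed.

Definition Xcode (x : X) : 'rV['F_p]_m := xchoose (Xcode_ex x).

Lemma XcodeK : cancel Xcode (fun v => Xpoly (rVpoly v)).
Proof. by move=> x; exact/eqP/(xchooseP (Xcode_ex x)). Qed.

HB.instance Definition _ := CanIsCountable XcodeK.
HB.instance Definition _ : isFinite X := CanIsFinite XcodeK.

Definition Xquandle : quandle := @alexander X Xt Xtinv Xt_V.

Section Cocycle.
Variables m1 m2 : nat.

Definition f_fun (x1 x2 : X) : X := (x1 - x2) ^+ (p ^ m1) * x2 ^+ (p ^ m2).

Hypothesis p_prime : prime p.

Lemma XexprD k (x y : X) :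
  (x + y) ^+ (p ^ k) = x ^+ (p ^ k) + y ^+ (p ^ k).
Proof.
have [v <-] := Xpoly_surj x; have [w <-] := Xpoly_surj y.
rewrite -!rmorphXn -!rmorphD -rmorphXn; congr Xpoly.
apply: GRing.exprDn_pchar; rewrite (eq_pnat _ (pchar_lalg _)) pnatX.
by rewrite pnatE // pchar_Fp.
Qed.

Lemma XexprB k (x y : X) :
  (x - y) ^+ (p ^ k) = x ^+ (p ^ k) - y ^+ (p ^ k).
Proof. by apply/eqP; rewrite eq_sym subr_eq -XexprD subrK. Qed.

Hypothesis xi_div :
  divides (poly_laurent (xi p m)) (1 - laurent_t 'F_p ^+ (p ^ m1 + p ^ m2)).

Lemma Xt_pow : Xt ^+ (p ^ m1 + p ^ m2) = 1.
Proof.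
apply/esym/eqP; rewrite -subr_eq0 /Xt -rmorphXn -(rmorph1 Xclass) -rmorphB.
by rewrite -(rmorph0 Xclass); apply/eqP/quot_classP; rewrite subr0.
Qed.

Let cocycle_e1 (t x y z : X) : t * x + (1 - t) * y - z = t * (x - y) + (y - z).
Proof. by rewrite mulrBl mul1r mulrBr [y - t * y]addrC !addrA. Qed.

Let cocycle_e2 (t x y z : X) :
  t * x + (1 - t) * z - (t * y + (1 - t) * z) = t * (x - y).
Proof. by rewrite opprD addrACA subrr addr0 -mulrBr. Qed.

Let cocycle_e3 (t y z : X) : t * y + (1 - t) * z = t * (y - z) + z.
Proof. by rewrite -[LHS]subr0 cocycle_e1 subr0. Qed.

Let cocycle_e4 (T1 T2 D E F Z : X) : T1 * T2 = 1 ->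
  D * (F + Z) + (T1 * D + E) * Z = (D + E) * Z + T1 * D * (T2 * F + Z).
Proof.
move=> T12; rewrite [T1 * D * _]mulrDr [T1 * D * (T2 * F)]mulrACA T12 mul1r.
rewrite mulrDr !mulrDl [D * F + D * Z]addrC -!addrA; congr (_ + _).
by rewrite addrA addrC.
Qed.

Fact f_cocycle2P : is_cocycle2 (X := Xquandle) f_fun.
Proof.
split=> [x|x y z]; rewrite /f_fun.
  by rewrite subrr expr0n expn_eq0 -leqn0 leqNgt prime_gt0 //= mul0r.
rewrite /quandle_op /= /alexander_op.
rewrite cocycle_e1 cocycle_e2 cocycle_e3 -(subrKA y x (- z)).
set d := x - y; set e := y - z; have -> : y = e + z by rewrite subrK.
clearbody d e; rewrite !XexprD !exprMn.
by apply: cocycle_e4; rewrite -exprD Xt_pow.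
Qed.

Definition f_cocycle : cocycle2 Xquandle X := Cocycle2 f_cocycle2P.
End Cocycle.
End Xring.

Definition mset_opp (A : zmodType) (M : {mset A}%mset) : {mset A}%mset :=
  seq_mset [seq - x | x <- M].

(* {⊔_n g(s) | s in S} *)
Definition mset_copies (S : finType) (A : choiceType) (n : nat) (g : S -> A) :
  {mset A}%mset := seq_mset (flatten [seq nseq n (g s) | s <- enum S]).

(* Main.v *)
Require Import Defs.
From mathcomp Require Import all_boot all_order all_algebra finmap multiset.
From mathcomp Require Import ring.

Set Implicit Arguments.
Unset Strict Implicit.
Unset Printing Implicit Defensive.

Import GRing.Theory.
Local Open Scope ring_scope.

(** Write [u = - t].  Number the crossings of the closed braid from top to
    bottom, and let [l_k], [r_k] be the colors of the left and right strings
    above the [k]-th one.  At a positive crossing the right string passes over,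
    so [l_(k+1) = r_k] and [r_(k+1) = t l_k + (1 - t) r_k]; hence the difference
    [l_k - r_k] is multiplied by [u] at each step, and [r_k] grows by [t] times
    that difference.  With [S_k = 1 + u + ... + u^(k-1)], this gives
    [l_k - r_k = u^k d] and [r_k = r + t d S_k], where [(d, r)] describes the top
    of the braid.  Since [S_m] is the class of [xi_m], it vanishes in [X], and so
    does [u^m - 1 = (u - 1) S_m]: every pair [(d, r)] closes up, and the
    colorings are in bijection with [X * X] ([closed_braid2_invariant]).

    The weight of the coloring [(d, r)] is the sum over [k < m] of
    [(u^k d)^a1 (r + t d S_k)^a2].  Powers by [a1] and [a2] are additive, so the
    [r]-part is [d^a1 r^a2 (S_m)^a1 = 0]: the weight depends on [d] only,
    whence the [|X|] copies of each value.  As [t^(a1+a2) = 1], also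
    [u^(a1+a2) = 1], and with [u^m = 1] this gives [(u^k)^a1 = (u^(m-k))^a2].
    The rest of the weight is thus [d^(a1+a2)] times the [a2]-th power of
    [t * (sum over k < m of u^(m-k) S_k)].  Counting monomials, the inner sum is
    the sum of [l u^l] over [l < m], which is [t xi_m'(t)]; this is the
    evaluation in [frobenius_weight].

    For the negative braid no second computation is made: reading the positive
    closed braid upwards turns it into the negative one.  A diagram with all
    orientations and all signs reversed has the same source arcs and the same
    colorings, and its weights change sign
    ([cocycle_invariant_reverse_mirror]). *)

(** * Multisets indexed by finite sets *)

Lemma seq_mset_reindex (S T : finType) (K : choiceType) (A : {set S})
    (B : {set T}) (h : S -> T) (h' : T -> S) (v : S -> K) (w : T -> K) :
    {in A, forall x, h x \in B} -> {in B, forall y, h' y \in A} ->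
    {in A, cancel h h'} -> {in B, cancel h' h} ->
    {in A, forall x, v x = w (h x)} ->
  seq_mset [seq v x | x <- enum A] = seq_mset [seq w y | y <- enum B].
Proof.
move=> hAB hBA hK h'K vw; apply/eq_seq_msetP.
have -> : [seq v x | x <- enum A] = [seq w y | y <- [seq h x | x <- enum A]].
  by rewrite -map_comp; apply/eq_in_map => x; rewrite mem_enum => /vw.
apply/perm_map/uniq_perm; rewrite ?enum_uniq //.
  rewrite map_inj_in_uniq ?enum_uniq // => x y; rewrite !mem_enum => xA yA eqh.
  by rewrite -(hK x xA) eqh hK.
move=> y; rewrite mem_enum; apply/mapP/idP=> [[x + ->]|yB].
  by rewrite mem_enum => /hAB.
by exists (h' y); rewrite ?mem_enum ?hBA ?h'K.
Qed.

Lemma mset_opp_seq (A : zmodType) (s : seq A) :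
  mset_opp (seq_mset s) = seq_mset [seq - x | x <- s].
Proof. exact/eq_seq_msetP/perm_map/perm_eq_seq_mset. Qed.

(** The form in which the copies arise: one for each value of a second
    coordinate on which the weight does not depend. *)
Lemma mset_copies_prod (S T : finType) (A : choiceType) (g : S -> A) :
  mset_copies #|T| g = seq_mset [seq g x.1 | x : S * T <- enum [set: S * T]].
Proof.
apply/eq_seq_msetP; rewrite perm_sym.
have -> : flatten [seq nseq #|T| (g s) | s <- enum S] =
          [seq g x.1 | x <- [seq (s, y) | s <- enum S, y <- enum T]].
  rewrite map_allpairs; congr flatten; apply: eq_map => s /=.
  by rewrite cardE; elim: (enum T) => //= _ l ->.
apply/perm_map/uniq_perm; rewrite ?enum_uniq //.
  by apply: allpairs_uniq; rewrite ?enum_uniq // => -[? ?] [? ?].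
move=> [s y]; rewrite mem_enum inE; apply/esym/allpairsP.
by exists (s, y); rewrite !mem_enum.
Qed.

(** * Colorings of edges *)

(** Arcs are classes of edges.  Colorings of arcs are traded for colorings of
    edges that do not change along an over-strand, so that colors can be
    computed crossing by crossing and transported along maps of edges. *)

Section EdgeColorings.
Variables (D : diagram) (X : quandle).

Definition source_edge (tau : crossing D) : edge D :=
  if positive tau then under_in tau else under_out tau.
Definition target_edge (tau : crossing D) : edge D :=
  if positive tau then under_out tau else under_in tau.

Definition edge_colorings : {set {ffun edge D -> X}} :=
  [set c : {ffun edge D -> X} |
    [forall tau, (c (over_out tau) == c (over_in tau)) &&
     (c (target_edge tau) ==
        quandle_op (c (source_edge tau)) (c (over_in tau)))]].

Lemma edge_coloringsP (c : {ffun edge D -> X}) :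
  reflect (forall tau, c (over_out tau) = c (over_in tau) /\
     c (target_edge tau) = quandle_op (c (source_edge tau)) (c (over_in tau)))
    (c \in edge_colorings).
Proof.
rewrite inE; apply: (iffP forallP) => cP tau; last first.
  by have [-> ->] := cP tau; rewrite !eqxx.
by have /andP[/eqP ? /eqP ?] := cP tau.
Qed.

Lemma over_step_sym : connect_sym (@over_step D).
Proof.
apply: sym_connect_sym => e e'; apply: eq_existsb => tau.
by rewrite orbC; congr orb; rewrite andbC.
Qed.

Lemma arc_of_over (tau : crossing D) :
  arc_of (over_out tau) = arc_of (over_in tau).
Proof.
apply/val_inj/setP => e /=; rewrite !inE.
apply: (same_connect over_step_sym); apply: connect1.
by apply/existsP; exists tau; rewrite !eqxx orbT.
Qed.

Definition arc_edge (a : Defs.arc D) : edge D := iinv (valP a).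

Lemma arc_edgeK : cancel arc_edge (@arc_of D).
Proof. by move=> a; apply/val_inj/f_iinv. Qed.

(** The set of edges that carry the color of [e] is closed under passing over a
    crossing, hence contains the whole arc of [e]. *)
Lemma edge_coloring_arc (c : {ffun edge D -> X}) (e e' : edge D) :
  c \in edge_colorings -> arc_of e = arc_of e' -> c e = c e'.
Proof.
move=> /edge_coloringsP cP /(congr1 val)/setP/(_ e').
rewrite !inE connect0 => ee'.
have closed_c : closed (@over_step D) [pred x | c x == c e].
  move=> x y /existsP[tau]; have [co _] := cP tau.
  by case/orP => /andP[/eqP -> /eqP ->]; rewrite !inE co.
by have := closed_connect closed_c ee'; rewrite !inE eqxx => /esym/eqP.
Qed.

Variables (A : zmodType) (phi : cocycle2 X A).

Definition edge_weight (c : {ffun edge D -> X}) : A :=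
  \sum_(tau : crossing D)
     phi (c (source_edge tau)) (c (over_in tau)) *~ crossing_sign tau.

Lemma cocycle_invariant_edges :
  cocycle_invariant D phi =
    seq_mset [seq edge_weight c | c <- enum edge_colorings].
Proof.
have srcE tau : source_arc tau = arc_of (source_edge tau) by [].
have tgtE tau : target_arc tau = arc_of (target_edge tau) by [].
apply: (seq_mset_reindex
          (h := fun C : {ffun Defs.arc D -> X} => [ffun e => C (arc_of e)])
          (h' := fun c : {ffun edge D -> X} => [ffun a => c (arc_edge a)])).
- move=> C; rewrite inE => /forallP CP; apply/edge_coloringsP => tau.
  by rewrite !ffunE arc_of_over; split=> //; have /eqP := CP tau.
- move=> c cP; rewrite inE; apply/forallP => tau.
  have e2a e : c (arc_edge (arc_of e)) = c e.
    by apply: edge_coloring_arc; rewrite ?arc_edgeK.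
  by rewrite srcE tgtE !ffunE !e2a; have /edge_coloringsP/(_ tau)[_ ->] := cP.
- by move=> C _; apply/ffunP => a; rewrite !ffunE arc_edgeK.
- move=> c cP; apply/ffunP => e; rewrite !ffunE.
  by apply: edge_coloring_arc; rewrite ?arc_edgeK.
- by move=> C _; apply: eq_bigr => tau _; rewrite !ffunE.
Qed.

End EdgeColorings.

(** The source under-arc is the incoming one at a positive crossing and the
    outgoing one at a negative crossing, so that exchanging both signs and
    directions leaves it in place.  Colorings are therefore the same, and only
    the sign in front of each term changes.  The maps [fe] and
    [fc] identify [D'] with this reversed mirror image of [D]. *)
Lemma cocycle_invariant_reverse_mirror (D D' : diagram) (X : quandle)
    (A : zmodType) (phi : cocycle2 X A) (fe : edge D -> edge D')
    (fc : crossing D -> crossing D') :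
    bijective fe -> bijective fc ->
    (forall tau, positive (fc tau) = ~~ positive tau) ->
    (forall tau, over_in (fc tau) = fe (over_out tau)) ->
    (forall tau, over_out (fc tau) = fe (over_in tau)) ->
    (forall tau, under_in (fc tau) = fe (under_out tau)) ->
    (forall tau, under_out (fc tau) = fe (under_in tau)) ->
  cocycle_invariant D' phi = mset_opp (cocycle_invariant D phi).
Proof.
move=> [fe' feK fe'K] [fc' fcK fc'K] posE oiE ooE uiE uoE.
have srcE tau : source_edge (fc tau) = fe (source_edge tau).
  by rewrite /source_edge posE uiE uoE; case: (positive tau).
have tgtE tau : target_edge (fc tau) = fe (target_edge tau).
  by rewrite /target_edge posE uiE uoE; case: (positive tau).
rewrite !cocycle_invariant_edges mset_opp_seq -map_comp.
apply: (seq_mset_reindex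
          (h := fun c : {ffun edge D' -> X} => [ffun e => c (fe e)])
          (h' := fun c : {ffun edge D -> X} => [ffun e => c (fe' e)])).
- move=> c /edge_coloringsP cP; apply/edge_coloringsP => tau.
  rewrite !ffunE; have [] := cP (fc tau).
  by rewrite oiE ooE srcE tgtE => ->.
- move=> c /edge_coloringsP cP; apply/edge_coloringsP => tau.
  rewrite !ffunE -(fc'K tau) oiE ooE srcE tgtE !feK.
  by have [-> ->] := cP (fc' tau).
- by move=> c _; apply/ffunP => e; rewrite !ffunE fe'K.
- by move=> c _; apply/ffunP => e; rewrite !ffunE feK.
- move=> c /edge_coloringsP cP; rewrite /= /edge_weight -sumrN.
  rewrite (reindex fc) /=; last by exists fc' => ? _.
  apply: eq_bigr => tau _; rewrite !ffunE srcE oiE.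
  (* The two diagrams use opposite halves of the over-strand to name its color. *)
  have [] := cP (fc tau); rewrite oiE ooE => -> _.
  by rewrite /crossing_sign posE; case: (positive tau); rewrite /= ?mulrN1z ?opprK.
Qed.

(** * Geometric sums *)

Section GeometricSums.
Variable R : pzRingType.
Implicit Types u : R.

Definition geom u (k : nat) : R := \sum_(i < k) u ^+ i.

Lemma geomS u k : geom u k.+1 = geom u k + u ^+ k.
Proof. by rewrite /geom big_ord_recr. Qed.

Lemma geom_eq0_expr u m : geom u m = 0 -> u ^+ m = 1.
Proof.
by move=> g0; apply/eqP; rewrite -subr_eq0 subrX1 -/(geom u m) g0 mulr0.
Qed.

(** Multiplying [S_k] by [u^(n-k)] gives the monomials [u^l] with
    [n - k <= l < n], so that [u^l] occurs once for each of the [l] indices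
    [k >= n - l]. *)
Lemma sum_geom u n :
  \sum_(k < n) u ^+ (n - k) * geom u k = \sum_(l < n) u ^+ l *+ l.
Proof.
elim: n => [|n IHn]; first by rewrite !big_ord0.
rewrite big_ord_recr [RHS]big_ord_recl /= mulr0n add0r subSn // subnn expr1.
under eq_bigr => k _ do rewrite subSn ?(ltnW (ltn_ord k)) // exprS -mulrA.
rewrite -mulr_sumr IHn /geom -mulrDr -big_split mulr_sumr.
by apply: eq_bigr => l _ /=; rewrite -mulrSr mulrnAr -exprS.
Qed.

End GeometricSums.

(** * Closures of two-string braids *)

(** Separating the sign from the number of crossings gives both torus diagrams
    the same edges and crossings, so that one can be mapped to the other. *)
Definition closed_braid2 (m : nat) (pos : bool) : diagram :=
  {| edge := ('I_m * bool)%type;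
     crossing := 'I_m;
     over_in := fun k => (k, pos);
     over_out := fun k => (ordS k, ~~ pos);
     under_in := fun k => (k, ~~ pos);
     under_out := fun k => (ordS k, pos);
     positive := fun=> pos |}.

Lemma torus_link2_pos (m : nat) :
  (0 < m)%N -> torus_link2 m%:Z = closed_braid2 m true.
Proof. by move=> m_gt0; rewrite /torus_link2 ltz_nat m_gt0. Qed.

Lemma torus_link2_neg (m : nat) :
  torus_link2 (- m%:Z) = closed_braid2 m false.
Proof.
have e : (0 < - m%:Z) = false by rewrite Num.Theory.oppr_gt0 ltz_nat.
by rewrite /torus_link2 e abszN.
Qed.

(** The identity behind reading a closed braid upwards: the crossing [rev_ord k]
    lies between the edge levels [ordS (rev_ord k)] and [rev_ord k], the images
    of the levels [k] and [ordS k]. *)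
Lemma ordS_rev_ordS (m : nat) (k : 'I_m) : ordS (rev_ord (ordS k)) = rev_ord k.
Proof.
apply: val_inj => /=; have km := ltn_ord k.
have m_gt0 : (0 < m)%N by apply: leq_ltn_trans km.
case: (ltngtP k.+1 m) => [k1m|/(leq_trans km)|k1m]; last 1 first.
- by rewrite k1m modnn subn1 prednK // modnn subnn.
- by rewrite (modn_small k1m) -subSn // subSS modn_small // ltn_subrL.
- by rewrite ltnn.
Qed.

Lemma cocycle_invariant_torus_neg (m : nat) (X : quandle) (A : zmodType)
    (phi : cocycle2 X A) : (0 < m)%N ->
  cocycle_invariant (torus_link2 (- m%:Z)) phi =
    mset_opp (cocycle_invariant (torus_link2 m%:Z) phi).
Proof.
move=> m_gt0; rewrite torus_link2_neg torus_link2_pos //.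
pose re (k : 'I_m) := ordS (rev_ord k).
have reK : involutive re by move=> k; rewrite /re ordS_rev_ordS rev_ordK.
apply: (@cocycle_invariant_reverse_mirror (closed_braid2 m true)
          (closed_braid2 m false) _ _ _
          (fun e => (re e.1, e.2)) (@rev_ord m)) => //=.
- by apply: inv_bij => -[k b]; rewrite /= reK.
- exact: inv_bij rev_ordK.
- by move=> k; rewrite /re ordS_rev_ordS.
- by move=> k; rewrite /re ordS_rev_ordS.
Qed.

Section AlexanderBraid.
Variables (R : finComPzRingType) (t tinv : R) (t_tinv : t * tinv = 1).
Local Notation u := (- t).
Variables (m : nat) (m_gt0 : (0 < m)%N).

(** The color of a string above the [k]-th crossing of the open positive braid,
    where [r] is the color at the top right and [d] the difference of the top
    left and top right colors. *)
Definition strand (d r : R) (k : nat) (b : bool) : R :=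
  if b then r + t * d * geom u k else u ^+ k * d + (r + t * d * geom u k).

Lemma strandS_false d r k : strand d r k.+1 false = strand d r k true.
Proof. by rewrite /strand geomS exprS; ring. Qed.

Lemma strandS_true d r k :
  strand d r k.+1 true =
    alexander_op t (strand d r k false) (strand d r k true).
Proof. by rewrite /strand /alexander_op geomS; ring. Qed.

(** This is the condition for every coloring of the open braid to close up. *)
Hypothesis geom0 : geom u m = 0.

Lemma strand_period d r b : strand d r m b = strand d r 0 b.
Proof.
by rewrite /strand geom_eq0_expr // geom0 /geom big_ord0 expr0; case: b.
Qed.

Definition braid_colors (x : R * R) : {ffun 'I_m * bool -> R} :=
  [ffun e : 'I_m * bool => strand x.1 x.2 e.1 e.2].

Definition braid_top (c : {ffun 'I_m * bool -> R}) : R * R :=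
  let k0 := Ordinal m_gt0 in (c (k0, false) - c (k0, true), c (k0, true)).

(** At the last crossing [ordS] wraps around, and the equality expresses that
    the colors at the bottom of the braid are those at the top. *)
Lemma braid_colorsS x (k : 'I_m) b :
  braid_colors x (ordS k, b) = strand x.1 x.2 k.+1 b.
Proof.
rewrite ffunE /=; case: (ltngtP k.+1 m) => [k1m|/(leq_trans (ltn_ord k))|k1m].
- by rewrite modn_small.
- by rewrite ltnn.
- by rewrite k1m modnn strand_period.
Qed.

Local Notation Q := (alexander t_tinv).
Local Notation D := (closed_braid2 m true).

Lemma braid_colors_coloring x : braid_colors x \in edge_colorings D Q.
Proof.
apply/edge_coloringsP => k; rewrite /source_edge /target_edge /=.
by rewrite !braid_colorsS strandS_false strandS_true !ffunE.
Qed.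

Lemma braid_colorsK : cancel braid_colors braid_top.
Proof.
move=> [d r]; rewrite /braid_top !ffunE /= /strand /geom big_ord0.
by congr pair; ring.
Qed.

Lemma braid_topK : {in edge_colorings D Q, cancel braid_top braid_colors}.
Proof.
move=> c /edge_coloringsP cP; apply/ffunP => -[[k km] b]; rewrite ffunE /=.
elim: k km b => [|k IHk] km b.
  have -> : Ordinal km = Ordinal m_gt0 by apply: val_inj.
  by rewrite /strand /geom big_ord0; case: b; ring.
have km' := ltnW km; have := cP (Ordinal km').
rewrite /source_edge /target_edge /=.
have -> : ordS (Ordinal km') = Ordinal km.
  by apply: val_inj; rewrite /= modn_small.
rewrite -!IHk -strandS_true -strandS_false => -[cf ct].
by case: b; rewrite ?cf ?ct.
Qed.

Lemma closed_braid2_invariant (phi : cocycle2 Q R) (g : R -> R) :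
    (forall d r, \sum_(k < m) phi (strand d r k false) (strand d r k true) = g d) ->
  cocycle_invariant D phi = mset_copies #|R| g.
Proof.
move=> gE; rewrite mset_copies_prod cocycle_invariant_edges; apply/esym.
apply: (seq_mset_reindex (h := braid_colors) (h' := braid_top)) => //.
- by move=> x _; apply: braid_colors_coloring.
- by move=> x _; apply: braid_colorsK.
- exact: braid_topK.
- move=> [d r] _; rewrite /edge_weight /= -(gE d r).
  by apply: eq_bigr => k _; rewrite /source_edge /= !ffunE.
Qed.

End AlexanderBraid.

(** * Evaluation of the weights *)

Section FrobeniusWeight.
Variable R : comPzRingType.

Definition additive_power (a : nat) : Prop :=
  {morph (fun x : R => x ^+ a) : x y / x + y}.

Lemma additive_power0 a : additive_power a -> (0 : R) ^+ a = 0.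
Proof. by move=> aD; apply: (addIr (0 ^+ a)); rewrite add0r -aD addr0. Qed.

Lemma additive_powerN a (x : R) : additive_power a -> (- x) ^+ a = - x ^+ a.
Proof.
by move=> aD; apply/eqP; rewrite -addr_eq0 -aD addNr additive_power0.
Qed.

Lemma additive_power_sum a n (F : 'I_n -> R) : additive_power a ->
  (\sum_(i < n) F i) ^+ a = \sum_(i < n) F i ^+ a.
Proof.
move=> aD; apply: (big_morph (fun x : R => x ^+ a) aD).
exact: additive_power0.
Qed.

(** The exponents enter only through the additivity of the powers, from which
    [u^(a1+a2) = t^(a1+a2)] already follows, for [u = - t]: each of the two
    powers changes sign with its argument. *)
Lemma frobenius_weight (t d r : R) (m a1 a2 : nat) :
    additive_power a1 -> additive_power a2 ->
    t ^+ (a1 + a2) = 1 -> geom (- t) m = 0 ->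
  \sum_(k < m) ((- t) ^+ k * d) ^+ a1 * (r + t * d * geom (- t) k) ^+ a2 =
    (t * \sum_(l < m) (- t) ^+ l *+ l) ^+ a2 * d ^+ (a1 + a2).
Proof.
move=> a1D a2D ta g0; have um1 := geom_eq0_expr g0; set u := - t in g0 um1 *.
have ua : u ^+ (a1 + a2) = 1.
  by rewrite exprD !additive_powerN // mulrNN -exprD.
have u_shift (k : 'I_m) : (u ^+ k) ^+ a1 = (u ^+ (m - k)) ^+ a2.
  have ukmk : u ^+ k * u ^+ (m - k) = 1.
    by rewrite -exprD subnKC // ltnW.
  have ukma : (u ^+ (m - k)) ^+ (a1 + a2) = 1.
    by rewrite -exprM mulnC exprM ua expr1n.
  by rewrite -[LHS]mulr1 -ukma exprD mulrA -exprMn ukmk expr1n mul1r.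
have term_split (k : 'I_m) :
    (u ^+ k * d) ^+ a1 * (r + t * d * geom u k) ^+ a2 =
    (u ^+ k) ^+ a1 * (d ^+ a1 * r ^+ a2) +
    t ^+ a2 * d ^+ (a1 + a2) * (u ^+ (m - k) * geom u k) ^+ a2.
  have -> : (r + t * d * geom u k) ^+ a2 = r ^+ a2 + (t * d * geom u k) ^+ a2.
    exact: a2D.
  by rewrite !exprMn -u_shift exprD; ring.
rewrite (eq_bigr _ (fun k _ => term_split k)).
(* The first part sums to a multiple of [(geom u m) ^+ a1 = 0]. *)
rewrite big_split -mulr_suml -mulr_sumr -!additive_power_sum //=.
rewrite sum_geom -/(geom u m) g0 additive_power0 // mul0r add0r.
by rewrite exprMn; ring.
Qed.

End FrobeniusWeight.

(** * The torus links *)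

(** Multiplying by ['X] avoids the exponents [i - 1]; it accounts for one of
    the two factors [t] in the invariant. *)
Lemma mulX_deriv_xi (p m : nat) :
  'X * (xi p m)^`() = \sum_(i < m) (- 'X) ^+ i *+ i.
Proof.
rewrite raddf_sum mulr_sumr; apply: eq_bigr => -[[|i] _] _ /=.
  by rewrite expr0 derivC mulr0 mulr0n.
by rewrite deriv_exp derivN derivX mulN1r mulrnAr mulrN -mulNr -exprS.
Qed.

Theorem proposition3p1 (p m m1 m2 : nat) (p_prime : prime p)
    (m_gt0 : (0 < m)%N)
    (xi_div : divides (poly_laurent (xi p m))
                (1 - laurent_t 'F_p ^+ (p ^ m1 + p ^ m2))) :
  let X := Xring p m_gt0 in
  let f := f_cocycle m_gt0 p_prime xi_div in
  cocycle_invariant (torus_link2 m%:Z) f =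
    mset_copies #|{: X}|
      (fun s : X => (Xt p m_gt0 ^+ 2 * Xpoly m_gt0 (xi p m)^`()) ^+ (p ^ m2)
                      * s ^+ (p ^ m1 + p ^ m2)) /\
  cocycle_invariant (torus_link2 (- m%:Z)) f =
    mset_opp (cocycle_invariant (torus_link2 m%:Z) f).
Proof.
move=> X f; split; last exact: cocycle_invariant_torus_neg.
have XtE : Xt p m_gt0 = Xpoly m_gt0 'X by [].
have geom0 : geom (- Xt p m_gt0) m = 0.
  rewrite -(Xpoly_xi p m_gt0) /xi rmorph_sum; apply: eq_bigr => i _.
  by rewrite rmorphXn rmorphN.
have weight_sum : Xt p m_gt0 ^+ 2 * Xpoly m_gt0 (xi p m)^`() =
    Xt p m_gt0 * \sum_(l < m) (- Xt p m_gt0) ^+ l *+ l.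
  rewrite expr2 -mulrA XtE -rmorphM mulX_deriv_xi rmorph_sum; congr (_ * _).
  by apply: eq_bigr => i _; rewrite rmorphMn rmorphXn rmorphN.
rewrite torus_link2_pos //; apply: closed_braid2_invariant => // d r.
rewrite weight_sum -(@frobenius_weight _ _ d r); first last.
- exact: geom0.
- exact: Xt_pow xi_div.
- exact: XexprD.
- exact: XexprD.
by apply: eq_bigr => k _; rewrite /f /= /f_fun /strand addrK.
Qed.
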